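(* Let $\mathbb L\subset(Y,\tau)$ be a multi-based generalized strongly invertible link in a closed real 3-manifold and let $\mathfrak s^R$ be a real $\mathrm{spin}^c$ structure on $(Y,\tau)$. Then $(\mathcal{CFLR}^-(\mathbb L^{\sigma_s},\mathfrak s^R),D)$ is a natural invariant of $\mathbb L$. More precisely, for any strongly $\mathfrak s^R$-admissible real Heegaard diagrams $\mathcal H,\mathcal H'$ of $\mathbb L$, the change of diagram map $\Phi_{\mathcal H\to\mathcal H'}$ induces a chain homotopy equivalence $$\Phi^s_{\mathcal H\to\mathcal H'}:(\mathcal{CFLR}^-(\mathcal H,\mathfrak s^R)^{\sigma_s},D)\to(\mathcal{CFLR}^-(\mathcal H',\mathfrak s^R)^{\sigma_s},D),$$ and if $\mathcal H''$ is another such diagram, then $\Phi^s_{\mathcal H'\to\mathcal H''}\circ\Phi^s_{\mathcal H\to\mathcal H'}\simeq\Phi^s_{\mathcal H\to\mathcal H''}$ (chain homotopic).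
   Context: $\mathbb F$ is the field with two elements. A closed real 3-manifold $(Y,\tau)$ is a closed oriented 3-manifold with an orientation-preserving involution whose fixed set is 1-dimensional. A $\tau$-invariant link $L$ is generalized strongly invertible if it admits an orientation reversed by $\tau$ (components may be interchanged in pairs). A multi-based generalized strongly invertible link $\mathbb L=(L,\mathbf O,\mathbf X)$ is such an oriented link with disjoint finite $\tau$-invariant subsets $\mathbf O,\mathbf X\subset L$ such that every component contains at least two base points, $O$'s and $X$'s alternate along each component, and for each component $K=\tau(K)$ both points of $K\cap\mathrm{Fix}(\tau)$ are base points. $\mathbf O^f,\mathbf X^f$ are the $\tau$-fixed base points, $\mathbf O^p,\mathbf X^p$ the sets of pairs $(O,O'=\tau(O))$, $(X,X'=\tau(X))$ of non-fixed ones. Background (real Heegaard Floer homology of Guth–Manolescu). A real Heegaard diagram $\mathcal H=(\Sigma,\boldsymbol\alpha,\boldsymbol\beta,\mathbf O,\mathbf X,\tau)$ for $\mathbb L$ is an embedded Heegaard diagram for $(Y,\mathbb L)$ (each component of $\Sigma\setminus\boldsymbol\alpha$ and $\Sigma\setminus\boldsymbol\beta$ contains exactly one $O$ and one $X$) with $\tau(\Sigma)=\Sigma$, $\tau$ exchanging the handlebodies and $\tau(\boldsymbol\alpha)=\boldsymbol\beta$. Generators are the $\tau$-fixed points of $\mathbb T_\alpha\cap\mathbb T_\beta\subset\mathrm{Sym}^{|\boldsymbol\alpha|}(\Sigma)$; $\pi_2^R(\mathbf x,\mathbf y)$ is the set of homotopy classes of $\tau$-invariant Whitney disks, $\mu_R$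 the real Maslov index, $\#\widehat{\mathcal M}_R(\phi)$ the mod 2 count of invariant holomorphic representatives modulo translation for a generic symmetric almost complex structure, $n_p(\phi)$ the multiplicity at $p$. Real $\mathrm{spin}^c$ structures are $\mathrm{spin}^c$ structures with a conjugate-linear involutive lift of $\tau$; $\mathfrak s^R(\mathbf x)$ is the one determined by $\mathbf x$ and $\mathbf O$. Strong $\mathfrak s^R$-admissibility is Guth–Manolescu's real analogue of the Ozsváth–Szabó condition. $\mathcal R^-(\mathbb L)$ is the polynomial ring over $\mathbb F$ with variables $u_O$ ($O\in\mathbf O^f$), $U_O$ ($(O,O')\in\mathbf O^p$), $v_X$ ($X\in\mathbf X^f$), $V_X$ ($(X,X')\in\mathbf X^p$). $\mathcal{CFLR}^-(\mathcal H,\mathfrak s^R)$ is the free $\mathcal R^-(\mathbb L)$-module on generators with $\mathfrak s^R(\mathbf x)=\mathfrak s^R$, with $\partial\mathbf x=\sum_{\mathbf y}\sum_{\phi\in\pi_2^R(\mathbf x,\mathbf y),\mu_R(\phi)=1}\#\widehat{\mathcal M}_R(\phi)\prod u_O^{n_O(\phi)}\prod U_O^{n_O(\phi)}\prod v_X^{n_X(\phi)}\prod V_X^{n_X(\phi)}\mathbf y$. It satisfies $\partial^2=\omega_{\mathbb L}\cdot\mathrm{id}$, where $\omega_{\mathbb L}=0$ if $\mathbb L$ is a knot with exactly one $O$ and one $X$, and otherwise $\omega_{\mathbb L}$ is the sum, over the $\tau$-orbits of segments of $L\setminus(\mathbf O\cup\mathbf X)$, of the product of the weights of the two endpoints, the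 weight being $U_O$, $V_X$ for points in pairs and $u_O^2$, $v_X^2$ for fixed points. Known naturality (Guth–Manolescu): for strongly $\mathfrak s^R$-admissible $\mathcal H,\mathcal H',\mathcal H''$ representing $\mathbb L$ there are change of diagram maps $\Phi_{\mathcal H\to\mathcal H'}:\mathcal{CFLR}^-(\mathcal H,\mathfrak s^R)\to\mathcal{CFLR}^-(\mathcal H',\mathfrak s^R)$, chain homotopy equivalences of curved complexes over $\mathcal R^-(\mathbb L)$, with $\Phi_{\mathcal H\to\mathcal H''}\simeq\Phi_{\mathcal H'\to\mathcal H''}\circ\Phi_{\mathcal H\to\mathcal H'}$. The ring $\mathcal R^-_s(\mathbb L)$ is the polynomial ring over $\mathbb F$ with one variable $u_O$ for each element of $\mathbf O^f\cup\mathbf O^p$ and one variable $v_X$ for each element of $\mathbf X^f\cup\mathbf X^p$. $\sigma_s:\mathcal R^-(\mathbb L)\to\mathcal R_s^-(\mathbb L)$ is the identity on $u_O$, $v_X$ for fixed base points and sends $U_O\mapsto u_O^2$, $V_X\mapsto v_X^2$. The superscript $\sigma_s$ denotes $-\otimes_{\mathcal R^-(\mathbb L)}\mathcal R_s^-(\mathbb L)$ with induced $\partial$. The bounding chain $\mathcal L\in\mathcal R_s^-(\mathbb L)$ is the unique square root of $\sigma_s(\omega_{\mathbb L})$: it is $0$ if $\mathbb L$ is a knot with one $O$ and one $X$, and otherwise the sum over $\tau$-orbits of segments of $L\setminus(\mathbf O\cup\mathbf X)$ of the products $u_Ov_X$ of the variables of their endpoints. $D=\partial+\mathcal L\cdot\mathrm{id}$,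 so $D^2=0$. *)

(* Defs.v *)
(* Mathematical Components, with multinomials for polynomial rings and the
   classical layer of MathComp-Analysis for finitely supported sums. *)
From HB Require Import structures.
From mathcomp Require Import all_boot all_order all_fingroup all_algebra.
From mathcomp Require Import boolp classical_sets cardinality fsbigop.
From mathcomp Require Import mpoly.

Set Implicit Arguments.
Unset Strict Implicit.
Unset Printing Implicit Defensive.

Import GRing.Theory.
Local Open Scope ring_scope.

(** * Curved complexes and extension of scalars *)

(* The regular module R^o matters: a polynomial ring is also a module over its
   coefficients, and {ffun G -> R} would pick up that smaller scalar action. *)
Notation free_module R G := {ffun G -> R^o}.

Section Modules.
Variable R : comNzRingType.

Definition basis_vector (G : finType) (x : G) : free_module R G :=
  [ffun z => (z == x)%:R].

Definition linear_extension (G G' : finType) (a : G -> G' -> R)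
    (v : free_module R G) : free_module R G' :=
  [ffun y => \sum_x v x * a x y].

Lemma linear_extension_linear (G G' : finType) (a : G -> G' -> R) :
  linear (linear_extension a).
Proof.
move=> c u v; apply/ffunP=> y; rewrite !ffunE.
rewrite scaler_sumr -big_split /=; apply: eq_bigr => x _.
by rewrite !ffunE mulrDl scalerAl.
Qed.

HB.instance Definition _ (G G' : finType) (a : G -> G' -> R) :=
  GRing.isLinear.Build R (free_module R G) (free_module R G') *:%R
    (linear_extension a) (linear_extension_linear a).

Section Homotopy.
Variables M N : lmodType R.

Definition chain_map (dM : M -> M) (dN : N -> N) (f : M -> N) : Prop :=
  forall v, f (dM v) = dN (f v).

(* The boundary maps are not required to square to zero, so this covers
   curved complexes as well as ordinary ones. *)
Definition chain_homotopic (dM : M -> M) (dN : N -> N) (f g : M -> N) : Prop :=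
  exists h : {linear M -> N}, forall v, f v - g v = dN (h v) + h (dM v).
End Homotopy.

Definition chain_homotopy_equivalence (M N : lmodType R)
    (dM : M -> M) (dN : N -> N) (f : {linear M -> N}) : Prop :=
  chain_map dM dN f /\
  exists g : {linear N -> M},
    [/\ chain_map dN dM g,
        chain_homotopic dM dM (g \o f) idfun &
        chain_homotopic dN dN (f \o g) idfun].
End Modules.

(* For sigma : R -> S, the S-module (free_module R G) (x)_R S is free on the
   same basis G, and f (x) id_S has the matrix of f with sigma applied to each
   entry; its characteristic property is base_change_compat below. *)
Definition base_change (R S : comNzRingType) (sigma : R -> S) (G G' : finType)
    (f : free_module R G -> free_module R G') :
    {linear free_module S G -> free_module S G'} :=
  linear_extension (fun x y => sigma (f (basis_vector R x) y)).

Lemma base_change_compat (R S : comNzRingType) (sigma : {rmorphism R -> S})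
    (G G' : finType) (f : {linear free_module R G -> free_module R G'})
    (v : free_module R G) :
  base_change sigma f [ffun x => sigma (v x)] = [ffun y => sigma (f v y)].
Proof.
have {2}-> : v = \sum_x v x *: basis_vector R x.
  apply/ffunP=> z; rewrite sum_ffunE (bigD1 z) //= big1 => [|x xz].
    by rewrite !ffunE eqxx addr0 [RHS]mulr1.
  by rewrite !ffunE eq_sym (negbTE xz) [LHS]mulr0.
apply/ffunP=> y; rewrite !ffunE linear_sum sum_ffunE rmorph_sum /=.
by apply: eq_bigr => x _; rewrite ffunE linearZ ffunE rmorphM.
Qed.

(** * Multi-based generalized strongly invertible links *)

(* The base points of the link, in their cyclic order.  [next_bp] sends a base
   point to the following one along the orientation of its component, so that
   components are the orbits of [next_bp] (each component carries base points),
   and a base point b stands for the segment from b to [next_bp b] as well.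
   That a component has at least two base points follows from alternation. *)
Record based_link := BasedLink {
  bp : finType;
  isX : pred bp;
  next_bp : {perm bp};
  tau : bp -> bp;
  isX_next : forall b, isX (next_bp b) = ~~ isX b;
  tauK : involutive tau;
  isX_tau : forall b, isX (tau b) = isX b;
  (* tau reverses the orientation *)
  next_tau_next : forall b, next_bp (tau (next_bp b)) = tau b;
  (* an invariant component meets Fix(tau) in exactly two points, and both are
     base points *)
  fixed_bp : forall b, tau b \in porbit next_bp b ->
    #|[set c in porbit next_bp b | tau c == c]| = 2%N
}.

Section BasedLink.
Variable L : based_link.

Lemma froots_tau (b : bp L) : froots (@tau L) (froot (@tau L) b).
Proof. exact: roots_root (fconnect_sym (inv_inj (@tauK L))) b. Qed.

(* Canonical representatives of the tau-orbits of base points, that is, of the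
   elements of O^f, O^p, X^f and X^p. *)
Definition bp_orbit := {b : bp L | froots (@tau L) b}.
Definition bp_orbit_of (b : bp L) : bp_orbit := Sub (froot _ b) (froots_tau b).

Definition fixed_orbit (o : bp_orbit) : bool := tau (val o) == val o.

Definition nvars : nat := #|{: bp_orbit}|.

(* The segment from b to [next_bp b] is sent by tau, reversed, to the one from
   [tau (next_bp b)] to [tau b]. *)
Definition segment_tau (b : bp L) : bp L := tau (next_bp L b).

(* A component with a single O and a single X. *)
Definition is_minimal_knot : bool :=
  [&& #|porbits (next_bp L)| == 1%N, #|[set b : bp L | ~~ isX b]| == 1%N
    & #|[set b : bp L | isX b]| == 1%N].
End BasedLink.

(* Both R^-(L) and R_s^-(L) have exactly one variable for each orbit of base
   points; they are told apart by the role they play in [sigma_s]. *)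
Notation Rminus L := {mpoly 'F_2[nvars L]} (only parsing).
Notation Rminus_s L := {mpoly 'F_2[nvars L]} (only parsing).

Section Rings.
Variable L : based_link.

Definition var (o : bp_orbit L) : Rminus L := 'X_(enum_rank o).
Definition var_s (o : bp_orbit L) : Rminus_s L := 'X_(enum_rank o).

Definition weight (b : bp L) : Rminus L :=
  let o := bp_orbit_of b in if fixed_orbit o then var o ^+ 2 else var o.

(* [froots (segment_tau)] picks one segment in each tau-orbit of segments;
   the choice is immaterial, as weights are tau-invariant. *)
Definition omega : Rminus L :=
  if is_minimal_knot L then 0 else
  \sum_(b | froots (@segment_tau L) b) weight b * weight (next_bp L b).

Definition bounding_chain : Rminus_s L :=
  if is_minimal_knot L then 0 else
  \sum_(b | froots (@segment_tau L) b)
     var_s (bp_orbit_of b) * var_s (bp_orbit_of (next_bp L b)).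

Definition sigma_s : Rminus L -> Rminus_s L :=
  comp_mpoly [tuple (let o := enum_val i in
                     if fixed_orbit o then var_s o else var_s o ^+ 2)
             | i < nvars L].

Lemma addFF (p : Rminus_s L) : p + p = 0.
Proof.
have two0 : 2%:R = 0 :> 'F_2 by apply/val_inj.
by rewrite -mulr2n -mulr_natr -mpolyC_nat two0 mpolyC0 mulr0.
Qed.

Lemma sqrrD_FF (p q : Rminus_s L) : (p + q) ^+ 2 = p ^+ 2 + q ^+ 2.
Proof. by rewrite sqrrD mulr2n addFF addr0. Qed.

Lemma sigma_s_weight (b : bp L) :
  sigma_s (weight b) = var_s (bp_orbit_of b) ^+ 2.
Proof.
rewrite /weight /sigma_s /=; case: ifP => h;
  by rewrite ?rmorphXn /= comp_mpolyXU -tnth_nth tnth_mktuple /= enum_rankK h.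
Qed.

Lemma bounding_chainP (p : Rminus_s L) :
  p ^+ 2 = sigma_s omega <-> p = bounding_chain.
Proof.
have sq : bounding_chain ^+ 2 = sigma_s omega.
  rewrite /bounding_chain /omega; case: ifP => _.
    by rewrite expr0n /sigma_s comp_mpoly0.
  rewrite (big_morph (fun q => q ^+ 2) sqrrD_FF (expr0n _ 2)) /sigma_s raddf_sum.
  apply: eq_bigr => b _.
  by rewrite [RHS]rmorphM /= -!/(sigma_s _) !sigma_s_weight exprMn.
split=> [|->//]; rewrite -sq => /eqP; rewrite eqf_sqr => /orP[] /eqP -> //.
by apply/eqP; rewrite -subr_eq0 -opprD addFF oppr0.
Qed.
End Rings.

(** * Real Heegaard diagrams *)

(* The combinatorial part of a real Heegaard diagram: the curves alpha_c and
   beta_c = tau(alpha_c), the intersection points of alpha and beta curves, and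
   the components ("regions") of the complement of all curves.  A component of
   Sigma \ alpha is a union of regions, and tau identifies the components of
   Sigma \ beta with those of Sigma \ alpha. *)
Record heegaard_pattern (L : based_link) := HeegaardPattern {
  curve : finType;
  ipoint : finType;
  alpha_of : ipoint -> curve;
  beta_of : ipoint -> curve;
  ipoint_tau : ipoint -> ipoint;
  ipoint_tauK : involutive ipoint_tau;
  alpha_of_tau : forall p, alpha_of (ipoint_tau p) = beta_of p;
  region : finType;
  region_tau : region -> region;
  region_tauK : involutive region_tau;
  bp_region : bp L -> region;
  bp_region_tau : forall b, bp_region (tau b) = region_tau (bp_region b);
  alpha_component : finType;
  alpha_component_of : region -> alpha_component;
  one_O : forall c, #|[set b | ~~ isX b &
                        alpha_component_of (bp_region b) == c]| = 1%N;
  one_X : forall c, #|[set b | isX b &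
                        alpha_component_of (bp_region b) == c]| = 1%N
}.

(* A point of T_alpha \cap T_beta is a set of intersection points with exactly
   one point on each alpha curve and exactly one on each beta curve. *)
Definition is_real_generator L (P : heegaard_pattern L) (x : {set ipoint P}) :=
  [&& [forall c, #|[set p in x | alpha_of p == c]| == 1%N],
      [forall c, #|[set p in x | beta_of p == c]| == 1%N]
    & [set ipoint_tau p | p in x] == x].

Definition real_generator L (P : heegaard_pattern L) :=
  {x : {set ipoint P} | is_real_generator x}.

(** * Real Heegaard Floer homology *)

(* The geometric and analytic input of real Heegaard Floer homology: real
   3-manifolds, their real spin^c structures, links in them, real Heegaard
   diagrams (each with a generic symmetric almost complex structure chosen),
   and invariant holomorphic disks. *)
Record real_floer_theory := RealFloerTheory {
  real_manifold : Type;
  real_spinc : real_manifold -> eqType;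
  gsi_link : real_manifold -> Type;
  link_pattern : forall Y, gsi_link Y -> based_link;
  real_diagram : forall Y, gsi_link Y -> Type;
  diagram_pattern : forall Y (L : gsi_link Y),
    real_diagram L -> heegaard_pattern (link_pattern L);
  spinc_of : forall Y (L : gsi_link Y) (H : real_diagram L),
    real_generator (diagram_pattern H) -> real_spinc Y;
  strongly_admissible : forall Y (L : gsi_link Y),
    real_diagram L -> real_spinc Y -> Prop;
  (* pi_2^R(x, y), with the domain, mu_R and the mod 2 count of each class *)
  real_disk : forall Y (L : gsi_link Y) (H : real_diagram L),
    real_generator (diagram_pattern H) -> real_generator (diagram_pattern H) ->
    choiceType;
  domain : forall Y (L : gsi_link Y) (H : real_diagram L)
    (x y : real_generator (diagram_pattern H)),
    real_disk x y -> region (diagram_pattern H) -> int;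
  real_maslov : forall Y (L : gsi_link Y) (H : real_diagram L)
    (x y : real_generator (diagram_pattern H)), real_disk x y -> int;
  disk_count : forall Y (L : gsi_link Y) (H : real_diagram L)
    (x y : real_generator (diagram_pattern H)), real_disk x y -> 'F_2;
  spinc_of_disk : forall Y (L : gsi_link Y) (H : real_diagram L)
    (x y : real_generator (diagram_pattern H)),
    real_disk x y -> spinc_of x = spinc_of y;
  domain_tau : forall Y (L : gsi_link Y) (H : real_diagram L)
    (x y : real_generator (diagram_pattern H)) (phi : real_disk x y) r,
    domain phi (region_tau r) = domain phi r;
  domain_ge0 : forall Y (L : gsi_link Y) (H : real_diagram L)
    (x y : real_generator (diagram_pattern H)) (phi : real_disk x y) r,
    real_maslov phi = 1 -> disk_count phi != 0 -> 0 <= domain phi r;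
  disk_finite : forall Y (L : gsi_link Y) (H : real_diagram L)
    (x y : real_generator (diagram_pattern H)),
    strongly_admissible H (spinc_of x) ->
    finite_set [set phi : real_disk x y |
                 real_maslov phi = 1 /\ disk_count phi != 0]%classic
}.

Section Complex.
Variables (T : real_floer_theory) (Y : real_manifold T) (L : gsi_link Y).
Variables (s : real_spinc Y) (H : real_diagram L).
Local Notation LP := (link_pattern L).
Local Notation HP := (diagram_pattern H).

Definition spinc_generator := {x : real_generator HP | spinc_of x == s}.

(* n_b(phi); natural-number exponents are harmless by [domain_ge0]. *)
Definition multiplicity (x y : real_generator HP) (phi : real_disk x y)
  (b : bp LP) : nat := `|domain phi (bp_region HP b)|%N.

Definition disk_weight (x y : real_generator HP) (phi : real_disk x y) :
    Rminus LP :=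
  \prod_(o : bp_orbit LP) var o ^+ multiplicity phi (val o).

Definition differential_coef (x y : real_generator HP) : Rminus LP :=
  \sum_(phi \in [set phi : real_disk x y | real_maslov phi = 1]%classic)
     (disk_count phi)%:MP * disk_weight phi.

Definition CFLR := free_module (Rminus LP) spinc_generator.

Definition CFLR_diff : {linear CFLR -> CFLR} :=
  linear_extension (fun x y : spinc_generator =>
                      differential_coef (val x) (val y)).

Definition CFLR_s := free_module (Rminus_s LP) spinc_generator.

Definition CFLR_s_diff : {linear CFLR_s -> CFLR_s} :=
  base_change (@sigma_s LP) CFLR_diff.

Definition CFLR_s_D : CFLR_s -> CFLR_s :=
  fun v => CFLR_s_diff v + bounding_chain LP *: v.
End Complex.

Arguments CFLR_s_D {T Y L} s H v.

Section Naturality.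
Variables (T : real_floer_theory) (Y : real_manifold T) (L : gsi_link Y).
Variable s : real_spinc Y.
Local Notation LP := (link_pattern L).
Local Notation admissible H := (strongly_admissible H s).

(* Only the values at strongly admissible diagrams are meaningful. *)
Definition change_of_diagram_maps := forall H H' : real_diagram L,
  {linear CFLR s H -> CFLR s H'}.

Definition curvature_formula : Prop := forall H : real_diagram L,
  admissible H -> forall v : CFLR s H,
  CFLR_diff s H (CFLR_diff s H v) = omega LP *: v.

Definition naturality (Phi : change_of_diagram_maps) : Prop :=
  (forall H H' : real_diagram L, admissible H -> admissible H' ->
     chain_homotopy_equivalence (CFLR_diff s H) (CFLR_diff s H') (Phi H H')) /\
  (forall H H' H'' : real_diagram L,
     admissible H -> admissible H' -> admissible H'' ->
     chain_homotopic (CFLR_diff s H) (CFLR_diff s H'')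
       (Phi H H'') (Phi H' H'' \o Phi H H')).

Definition induced_map (Phi : change_of_diagram_maps) (H H' : real_diagram L) :
    {linear CFLR_s s H -> CFLR_s s H'} :=
  base_change (@sigma_s LP) (Phi H H').
End Naturality.

(* Main.v *)
(* Extension of scalars along sigma_s preserves compositions and homotopies, so
   the change of diagram maps remain homotopy equivalences for the extended
   curved differential, naturally in the diagram.  Adding the same scalar to the
   differentials on both sides changes nothing: it commutes with every linear
   map, and its two contributions to a homotopy [dN h + h dM] cancel in
   characteristic two.  For the bounding chain the new differential squares to
   zero, since the cross terms cancel and the chain squares to the curvature. *)
Require Import Defs.
From mathcomp Require Import all_boot all_order all_fingroup all_algebra mpoly.
From HB Require Import structures.

Set Implicit Arguments.
Unset Strict Implicit.
Unset Printing Implicit Defensive.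

Import GRing.Theory.
Local Open Scope ring_scope.

Section BaseChange.
Variables (R S : comNzRingType) (sigma : {rmorphism R -> S}).

Lemma base_changeE (G G' : finType) (f : free_module R G -> free_module R G')
    (v : free_module S G) (y : G') :
  base_change sigma f v y = \sum_x v x * sigma (f (basis_vector R x) y).
Proof. by rewrite ffunE. Qed.

(** Base change reads a map only through its values on basis vectors, so pointwise identities over
    [R] descend to [S]; the later transport arguments all end this way. *)
Lemma eq_base_change (G G' : finType)
    (f g : free_module R G -> free_module R G') :
  f =1 g -> base_change sigma f =1 base_change sigma g.
Proof.
by move=> fg v; apply/ffunP=> y; rewrite !base_changeE; apply: eq_bigr => x _;
  rewrite fg.
Qed.

Lemma base_changeD (G G' : finType)
    (f g : free_module R G -> free_module R G') (v : free_module S G) :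
  base_change sigma (fun u => f u + g u) v =
  base_change sigma f v + base_change sigma g v.
Proof.
apply/ffunP=> y; rewrite [RHS]ffunE !base_changeE -big_split /=.
by apply: eq_bigr => x _; rewrite ffunE rmorphD mulrDr.
Qed.

Lemma base_changeB (G G' : finType)
    (f g : free_module R G -> free_module R G') (v : free_module S G) :
  base_change sigma (fun u => f u - g u) v =
  base_change sigma f v - base_change sigma g v.
Proof.
apply/eqP; rewrite eq_sym subr_eq -base_changeD; apply/eqP.
by apply: eq_base_change => u; rewrite subrK.
Qed.

(** The matrix of a scalar is diagonal. With [c] the curvature, this is how [omega] becomes its
    image under [sigma_s]. *)
Lemma base_change_scalar (G : finType) (c : R) (v : free_module S G) :
  base_change sigma (fun u : free_module R G => c *: u) v = sigma c *: v.
Proof.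
apply/ffunP=> y; rewrite base_changeE (bigD1 y) //= big1 => [|x xy].
  by rewrite !ffunE eqxx addr0 [c *: _]mulr1 mulrC.
by rewrite !ffunE eq_sym (negbTE xy) [c *: _]mulr0 rmorph0 mulr0.
Qed.

Lemma base_change_id (G : finType) (v : free_module S G) :
  base_change sigma (@idfun (free_module R G)) v = v.
Proof.
rewrite -[RHS]scale1r -(rmorph1 sigma) -base_change_scalar.
by apply: eq_base_change => u; rewrite scale1r.
Qed.

(** Composition is a matrix product, and [sigma] respects sums of products. *)
Lemma base_change_comp (G G' G'' : finType)
    (g : {linear free_module R G' -> free_module R G''})
    (f : free_module R G -> free_module R G') (v : free_module S G) :
  base_change sigma (g \o f) v = base_change sigma g (base_change sigma f v).
Proof.
apply/ffunP=> z; rewrite !base_changeE.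
under eq_bigr => x _.
  (* Column [x] of the product is [g] applied to column [x] of [f], so [base_change_compat] lets
     [sigma] pass through [g]. *)
  have -> : sigma ((g \o f) (basis_vector R x) z) =
            base_change sigma g [ffun y => sigma (f (basis_vector R x) y)] z.
    by rewrite base_change_compat ffunE.
  rewrite base_changeE mulr_sumr.
  over.
rewrite exchange_big /=; apply: eq_bigr => y _.
by rewrite base_changeE mulr_suml; apply: eq_bigr => x _; rewrite ffunE mulrA.
Qed.

Lemma base_change_chain_map (G G' : finType)
    (dM : {linear free_module R G -> free_module R G})
    (dN : {linear free_module R G' -> free_module R G'})
    (f : {linear free_module R G -> free_module R G'}) :
  chain_map dM dN f ->
  chain_map (base_change sigma dM) (base_change sigma dN) (base_change sigma f).
Proof.
by move=> fd v; rewrite -!base_change_comp; apply: eq_base_change.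
Qed.

Lemma base_change_chain_homotopic (G G' : finType)
    (dM : {linear free_module R G -> free_module R G})
    (dN : {linear free_module R G' -> free_module R G'})
    (f g : free_module R G -> free_module R G') :
  chain_homotopic dM dN f g ->
  chain_homotopic (base_change sigma dM) (base_change sigma dN)
    (base_change sigma f) (base_change sigma g).
Proof.
case=> h hP; exists (base_change sigma h) => v.
(* Each side of the homotopy relation is gathered into the base change of one map over [R], where
   [hP] equates the two. *)
rewrite -base_changeB -!base_change_comp -base_changeD.
exact: eq_base_change.
Qed.
End BaseChange.

Section Homotopy.
Variables (R : comNzRingType) (M N : lmodType R).

Lemma eq_chain_homotopic (dM : M -> M) (dN : N -> N) (f f' g g' : M -> N) :
  f =1 f' -> g =1 g' -> chain_homotopic dM dN f g ->
  chain_homotopic dM dN f' g'.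
Proof. by move=> ff' gg' [h hP]; exists h => v; rewrite -ff' -gg'. Qed.

Lemma chain_homotopic_sym (dM : M -> M) (dN : {linear N -> N}) (f g : M -> N) :
  chain_homotopic dM dN f g -> chain_homotopic dM dN g f.
Proof.
case=> h hP; exists (\- h : {linear M -> N}) => v /=.
by rewrite -opprB hP raddfN opprD.
Qed.

Lemma chain_map_add_scalar (a : R) (dM : M -> M) (dN : N -> N)
    (f : {linear M -> N}) :
  chain_map dM dN f ->
  chain_map (fun v => dM v + a *: v) (fun v => dN v + a *: v) f.
Proof. by move=> fd v; rewrite linearD linearZ fd. Qed.

(** The same [h] serves: it picks up [a *: h v] once from each differential. Characteristic two
    enters only through [a + a = 0]. *)
Lemma chain_homotopic_add_scalar (a : R) (dM : M -> M) (dN : N -> N)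
    (f g : M -> N) :
  a + a = 0 -> chain_homotopic dM dN f g ->
  chain_homotopic (fun v => dM v + a *: v) (fun v => dN v + a *: v) f g.
Proof.
move=> aa [h hP]; exists h => v.
by rewrite linearD linearZ addrACA -scalerDl aa scale0r addr0.
Qed.
End Homotopy.

Lemma base_change_square_zero (R S : comNzRingType)
    (sigma : {rmorphism R -> S}) (a : S) (w : R) (G : finType)
    (d : {linear free_module R G -> free_module R G}) :
  a + a = 0 -> a ^+ 2 = sigma w -> (forall v, d (d v) = w *: v) ->
  let D v := base_change sigma d v + a *: v in forall v, D (D v) = 0.
Proof.
move=> aa a2 dd D v; rewrite /D linearD linearZ scalerDr scalerA -expr2.
have -> : base_change sigma d (base_change sigma d v) = sigma w *: v.
  by rewrite -base_change_scalar -base_change_comp; apply: eq_base_change.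
(* The four terms pair up into two copies of [a ^+ 2 *: v], one of them the curvature, and two cross
   terms; the factors [a * (a + a)] and [a + a] vanish. *)
rewrite -a2 [X in _ + X = _]addrC addrACA -!scalerDl expr2 -mulrDr aa.
by rewrite mulr0 !scale0r addr0.
Qed.

Lemma base_change_equivalence (R S : comNzRingType) (sigma : {rmorphism R -> S})
    (a : S) (G G' : finType)
    (dM : {linear free_module R G -> free_module R G})
    (dN : {linear free_module R G' -> free_module R G'})
    (f : {linear free_module R G -> free_module R G'}) :
  a + a = 0 -> chain_homotopy_equivalence dM dN f ->
  chain_homotopy_equivalence (fun v => base_change sigma dM v + a *: v)
    (fun v => base_change sigma dN v + a *: v) (base_change sigma f).
Proof.
move=> aa [fd [g [gd gf fg]]]; split.
  exact/chain_map_add_scalar/base_change_chain_map.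
(* The homotopy inverse over [R], extended to [S], is again an inverse; its homotopies extend too,
   once base changes of composites and identities are rewritten. *)
exists (base_change sigma g); split.
- exact/chain_map_add_scalar/base_change_chain_map.
- apply: chain_homotopic_add_scalar => //.
  apply: eq_chain_homotopic (base_change_chain_homotopic sigma gf).
    exact: base_change_comp.
  exact: base_change_id.
- apply: chain_homotopic_add_scalar => //.
  apply: eq_chain_homotopic (base_change_chain_homotopic sigma fg).
    exact: base_change_comp.
  exact: base_change_id.
Qed.

(** Substitution of polynomials is a ring morphism; recording this for the name [sigma_s] makes the
    general lemmas applicable to it. *)
HB.instance Definition _ (L : based_link) :=
  GRing.RMorphism.copy (@sigma_s L) (comp_mpoly _).

Theorem corollary4p6 (T : real_floer_theory) (Y : real_manifold T)
    (L : gsi_link Y) (s : real_spinc Y)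
    (Phi : change_of_diagram_maps L s)
    (hcurv : curvature_formula L s) (hnat : naturality Phi) :
  (forall H : real_diagram L, strongly_admissible H s ->
     forall v : CFLR_s s H, CFLR_s_D s H (CFLR_s_D s H v) = 0%R) /\
  (forall H H' : real_diagram L,
     strongly_admissible H s -> strongly_admissible H' s ->
     chain_homotopy_equivalence (CFLR_s_D s H) (CFLR_s_D s H')
       (induced_map Phi H H')) /\
  (forall H H' H'' : real_diagram L,
     strongly_admissible H s -> strongly_admissible H' s ->
     strongly_admissible H'' s ->
     chain_homotopic (CFLR_s_D s H) (CFLR_s_D s H'')
       (induced_map Phi H' H'' \o induced_map Phi H H')
       (induced_map Phi H H'')).
Proof.
have aa := addFF (bounding_chain (link_pattern L)).
case: hnat => equiv functorial; split; [|split].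
- move=> H adm v.
  apply: (base_change_square_zero aa _ (hcurv H adm)).
  (* The characterization as the unique square root, read at the bounding chain itself, says that
     its square is the curvature. *)
  exact: (iffRL (bounding_chainP _) erefl).
- by move=> H H' adm adm'; apply: base_change_equivalence (equiv _ _ adm adm').
- move=> H H' H'' adm adm' adm''.
  (* [naturality] puts the direct map first and the composite second, hence the reversal. *)
  apply: chain_homotopic_add_scalar => //; apply: chain_homotopic_sym.
  apply: eq_chain_homotopic
    (base_change_chain_homotopic _ (functorial _ _ _ adm adm' adm'')) => //.
  exact: base_change_comp.
Qed.
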